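(* There is a constant $c>0$ such that $\tau_{\pm1}(d)\ge (cd)^{d/4}$ for all $d$ that are powers of $2$.
   Context: For an integer $d\ge1$, a sequence $v_1,\dots,v_t$ ($t\ge 2$) of vectors in $[-1,1]^d$ is called minimal if (i) $v_1+\dots+v_t\in[-1,1]^d$, and (ii) for every index set $S\subset\{1,\dots,t\}$ with $2\le |S|<t$, the sum $\sum_{i\in S}v_i$ lies outside $[-1,1]^d$. Let $\tau_{\pm1}(d)$ denote the largest $t$ for which there exists a minimal sequence of length $t$ all of whose vectors lie in $\{-1,+1\}^d$. *)

(* Defs.v *)
From mathcomp Require Import all_boot all_order all_algebra.
Set Implicit Arguments. Unset Strict Implicit. Unset Printing Implicit Defensive.
Import Order.TTheory GRing.Theory Num.Theory.
Local Open Scope ring_scope.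

(* A vector of Z^d (integer coordinates suffice: all vectors considered
   are in {-1,+1}^d, and so are all their subsums integral). *)
Definition pm1_vec (d : nat) (x : 'I_d -> int) : Prop :=
  forall j : 'I_d, x j = 1 \/ x j = -1.

Definition in_cube (d : nat) (x : 'I_d -> int) : Prop :=
  forall j : 'I_d, `|x j| <= 1.

Definition minimal_seq (t d : nat) (v : 'I_t -> 'I_d -> int) : Prop :=
  (2 <= t)%N /\
  in_cube (fun j => \sum_(i < t) v i j) /\
  (forall S : {set 'I_t}, (2 <= #|S| < t)%N ->
      ~ in_cube (fun j => \sum_(i in S) v i j)).

Definition pm1_minimal_seq (t d : nat) (v : 'I_t -> 'I_d -> int) : Prop :=
  (forall i, pm1_vec (v i)) /\ minimal_seq v.

(* Main.v *)
(** Put n = 2^m and d = 2n, and let x = walsh z be the Walsh transform of an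
integer vector z on the subsets of an m-set.  A sign matrix R in the style of
Hastad and Alon-Vu has two equal rows and otherwise expresses x_i, for sets i
in binary order, as about 2^(|i|-1) x_g minus few multiples of earlier terms,
where g is the predecessor of i; so an integer z with sum 0 and all |(R z)_i| <= 1
is either 0 or has l1-norm at least 2^(m n / 2 - O(n)) = (c d)^(d/4).

The vectors used are sg_s (H_s, R_s) and sg_s (- H_s, R_s), with H the Hadamard
matrix.  If a combination with multiplicities b, c lies in the cube, then by
Parseval w = sg (b - c) is 0 or plus or minus a unit vector, while
sg (b + c) = w + 2 z with z integral, and |R z| <= 1.  Replacing w by - w if
needed makes the sum of z zero, so the combination has either at most one term
or at least (c d)^(d/4) terms.  An integer vector in the kernel of R, whose signs
give sg, provides a combination with sum 0; its smallest subsequence of at least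
two terms with sum in the cube is minimal, hence long. *)

Require Import Defs.
From mathcomp Require Import all_boot all_order all_algebra zify ring.

Module Construction.
Set Implicit Arguments. Unset Strict Implicit. Unset Printing Implicit Defensive.
Import Order.TTheory GRing.Theory Num.Theory.
Local Open Scope ring_scope.

(** * Subsets of an m-set in binary order *)

Lemma sum_pow2_lt m (l : 'I_m) : (\sum_(x < m | x < l) 2 ^ x < 2 ^ l)%N.
Proof.
rewrite -(big_ord_widen_cond m xpredT (fun x => 2 ^ x)%N) ?(ltnW (ltn_ord l)) //.
by have := predn_exp 2 l; rewrite mul1n => <-; rewrite prednK ?expn_gt0.
Qed.

Section Walsh.
Variable m : nat.
Local Notation P := {set 'I_m}.
Implicit Types (a b i s I J : P).

Definition symd a b : P := [set x | (x \in a) (+) (x \in b)].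

Lemma symdK b : involutive (symd^~ b).
Proof. by move=> a; apply/setP=> x; rewrite !inE addbK. Qed.

Lemma symd0 a : symd a set0 = a.
Proof. by apply/setP=> x; rewrite !inE addbF. Qed.

Lemma symd_eq0 a b : (symd a b == set0) = (a == b).
Proof.
apply/eqP/eqP=> [/setP ab0|->]; apply/setP=> x; last by rewrite !inE addbb.
by have := ab0 x; rewrite !inE; case: (x \in a); case: (x \in b).
Qed.

Lemma symd_sub a J : J \subset a -> symd a J = a :\: J.
Proof.
move=> /subsetP Ja; apply/setP=> x; rewrite !inE.
by have := Ja x; case: (x \in J) => //= [->|] //; rewrite addbF.
Qed.

(** The position of [a] in the binary order on subsets. *)
Definition num a : nat := \sum_(x in a) 2 ^ x.

(** The bits above [l] cancel, and those of [a] below [l] add up to less than 2^l. *)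
Lemma num_lead_lt (l : 'I_m) a b : l \in b -> l \notin a ->
  (forall x : 'I_m, (l < x)%N -> (x \in a) = (x \in b)) -> (num a < num b)%N.
Proof.
move=> lb la hab; rewrite /num (bigID (fun x : 'I_m => (l < x)%N)) /=.
rewrite [X in (_ < X)%N](bigID (fun x : 'I_m => (l < x)%N)) /=.
rewrite (eq_bigl (fun x : 'I_m => (x \in b) && (l < x)%N)); last first.
  by move=> x; case: ltnP => h; rewrite ?andbF // hab.
rewrite ltn_add2l [ltnRHS](bigD1 l) /=; last by rewrite lb ltnn.
apply: (@leq_trans (2 ^ l)); last exact: leq_addr.
apply: leq_ltn_trans (sum_pow2_lt l).
rewrite [X in (_ <= X)%N](bigID (mem a)) /=.
rewrite (eq_bigl (fun x : 'I_m => (x < l)%N && (x \in a))) ?leq_addr // => x.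
rewrite -leqNgt leq_eqVlt andbC; case: eqP => [/val_inj->|] //=.
by rewrite (negPf la) andbF.
Qed.

Lemma lead_exists a b : a != b ->
  exists2 l : 'I_m, (l \in a) != (l \in b) &
    forall x : 'I_m, (l < x)%N -> (x \in a) = (x \in b).
Proof.
move=> ab; have [l0 hl0] : exists l, l \in symd a b.
  by apply/set0Pn; rewrite symd_eq0.
have [l hl hmax] := @arg_maxnP _ l0 (fun x => x \in symd a b) val hl0.
exists l; first by move: hl; rewrite inE; case: (_ \in a); case: (_ \in b).
move=> x lx; apply/eqP; apply: contraTT lx => hx; rewrite -leqNgt.
by apply: hmax; rewrite inE; move: hx; case: (_ \in a); case: (_ \in b).
Qed.

Lemma num_lead a b : (num a < num b)%N ->
  exists l : 'I_m, [/\ l \in b, l \notin a &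
    forall x : 'I_m, (l < x)%N -> (x \in a) = (x \in b)].
Proof.
move=> hab; have ab : a != b by apply: contraTneq hab => ->; rewrite ltnn.
have [l hl h] := lead_exists ab; exists l.
have [la|la] := boolP (l \in a).
  have lb : l \notin b by move: hl; rewrite la; case: (l \in b).
  by have := num_lead_lt la lb (fun x hx => esym (h x hx)); rewrite ltnNge (ltnW hab).
by split=> //; move: hl; rewrite (negPf la); case: (l \in b).
Qed.

Lemma num_inj : injective num.
Proof.
move=> a b hab; apply/eqP; apply/negP => /negP ab.
have [l hl h] := lead_exists ab.
have [la|la] := boolP (l \in a).
  have lb : l \notin b by move: hl; rewrite la; case: (l \in b).
  by have := num_lead_lt la lb (fun x hx => esym (h x hx)); rewrite hab ltnn.
have lb : l \in b by move: hl; rewrite (negPf la); case: (l \in b).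
by have := num_lead_lt lb la h; rewrite hab ltnn.
Qed.

Lemma num_sub a b : a \subset b -> (num a <= num b)%N.
Proof.
move=> ab; rewrite /num [X in (_ <= X)%N](bigID (mem a)) /=.
rewrite (eq_bigl (fun x : 'I_m => (x \in b) && (x \in a))) ?leq_addr // => x.
by have := subsetP ab x; case: (x \in a) => [->|] //; rewrite andbF.
Qed.

Lemma num_proper a b : a \proper b -> (num a < num b)%N.
Proof.
rewrite properEneq => /andP[ab /num_sub]; rewrite leq_eqVlt => /orP[/eqP/num_inj h|//].
by rewrite h eqxx in ab.
Qed.

(** If [J] has elements above [l], its largest one is in [b], hence in [a], and is removed from [a]:
    it becomes the leading difference. Otherwise [l] remains the leading difference. *)
Lemma num_symd_lt a b (l : 'I_m) J : l \in b -> l \notin a ->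
  (forall x : 'I_m, (l < x)%N -> (x \in a) = (x \in b)) ->
  J \subset b :\ l -> (num (symd a J) < num b)%N.
Proof.
move=> lb la hab hJ.
have lJ : l \notin J by apply/negP => /(subsetP hJ); rewrite !inE eqxx.
have [j0 /andP[j0J j0l]|noJ] := pickP (fun x => (x \in J) && (l < x)%N); last first.
  apply: (@num_lead_lt l) => // [|x lx]; first by rewrite inE (negPf la).
  by have := noJ x; rewrite /= lx andbT inE hab // => ->; rewrite addbF.
have [j /andP[jJ jl] hmax] :=
  @arg_maxnP _ j0 (fun x => (x \in J) && (l < x)%N) val (introT andP (conj j0J j0l)).
have jb : j \in b by have := subsetP hJ j jJ; rewrite !inE => /andP[].
apply: (@num_lead_lt j) => // [|x jx]; first by rewrite inE jJ hab // jb.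
have lx : (l < x)%N by apply: ltn_trans jx.
rewrite inE hab //; case: (boolP (x \in J)) => [xJ|_]; last by rewrite addbF.
have hxj : (x <= j)%N by apply: hmax; rewrite xJ lx.
by move: jx; rewrite ltnNge hxj.
Qed.

(** * Characters and the Walsh transform *)

Definition chi a s : int := \prod_x (-1) ^+ ((x \in a) && (x \in s)).

Lemma chiC a s : chi a s = chi s a.
Proof. by apply: eq_bigr => x _; rewrite andbC. Qed.

Lemma chi0 s : chi set0 s = 1.
Proof. by apply: big1 => x _; rewrite inE. Qed.

Lemma chi_symd a b s : chi (symd a b) s = chi a s * chi b s.
Proof.
rewrite /chi -big_split; apply: eq_bigr => x _ /=; rewrite !inE.
by case: (x \in a); case: (x \in b); case: (x \in s); rewrite //= ?mulr1 ?mul1r.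
Qed.

Lemma chi_pm1 a s : chi a s = 1 \/ chi a s = -1.
Proof.
rewrite /chi; elim/big_ind: _ => [|u v [->|->] [->|->]|x _]; try by [left|right].
by case: (_ && _); [right|left].
Qed.

Lemma chi_disjoint a s : [disjoint a & s] -> chi a s = 1.
Proof.
move=> /pred0P h; apply: big1 => x _; have := h x; rewrite /= => ->.
by [].
Qed.

Lemma chi1 (x : 'I_m) s : x \in s -> chi [set x] s = -1.
Proof.
move=> xs; rewrite /chi (bigD1 x) //= inE eqxx xs big1 ?mulr1 // => y yx.
by rewrite inE (negPf yx).
Qed.

Lemma sum_chi_sub I s :
  \sum_(J : P | J \subset I) chi J s = if [disjoint s & I] then 2 ^+ #|I| else 0.
Proof.
case: ifPn => [dis|ndis].
  rewrite (eq_bigr (fun=> 1)) => [|J JI].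
    rewrite sumr_const -natrX; congr (_%:R).
    by rewrite -card_powerset; apply: eq_card => J; rewrite inE.
  by apply: chi_disjoint; rewrite disjoint_sym; apply: disjointWr dis.
have [x /andP[xs xI]] : exists x, (x \in s) && (x \in I).
  by have /pred0Pn[x] := ndis; exists x.
(* Toggling [x] in J changes the sign of every term. *)
set S := LHS; suff : S = - S by lia.
rewrite {1}/S (reindex_inj (inv_inj (symdK [set x]))) /= -sumrN.
apply: eq_big => [J|J _]; last by rewrite chi_symd chi1 ?mulrN1.
apply/subsetP/subsetP => h y.
  move=> yJ; case: (eqVneq y x) => [->//|yx]; apply: h.
  by rewrite !inE yJ (negPf yx).
by rewrite !inE; case: (eqVneq y x) => [->//|yx]; rewrite addbF; apply: h.
Qed.

Lemma sum_chi_mul s t :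
  \sum_a chi a s * chi a t = if s == t then 2 ^+ m else 0.
Proof.
rewrite (eq_bigr (fun a => chi a (symd s t))) => [|a _].
  rewrite (eq_bigl (fun a : P => a \subset [set: 'I_m])) => [|a]; last by rewrite subsetT.
  rewrite sum_chi_sub cardsT card_ord -symd_eq0; congr (if _ then _ else _).
  apply/pred0P/eqP => [h|-> x]; last by rewrite /= inE.
  by apply/setP => x; have := h x; rewrite /= !inE andbT.
by rewrite !(chiC a) chi_symd.
Qed.

Definition walsh (z : P -> int) a : int := \sum_s chi a s * z s.

Lemma parseval z : \sum_a walsh z a ^+ 2 = 2 ^+ m * \sum_s z s ^+ 2.
Proof.
transitivity (\sum_s \sum_t (\sum_a chi a s * chi a t) * (z s * z t)).
  rewrite exchange_big /= (eq_bigr (fun a => \sum_s \sum_t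
     (chi a s * chi a t) * (z s * z t))) => [|a _].
    rewrite exchange_big [RHS]exchange_big; apply: eq_bigr => s _ /=.
    rewrite exchange_big; apply: eq_bigr => t _ /=.
    by rewrite mulr_suml; apply: eq_bigr => a _; rewrite /=; ring.
  rewrite expr2 /walsh mulr_suml; apply: eq_bigr => s _.
  by rewrite mulr_sumr; apply: eq_bigr => t _; ring.
rewrite mulr_sumr; apply: eq_bigr => s _; rewrite (bigD1 s) //= sum_chi_mul eqxx.
rewrite big1 ?addr0 // => t ts; rewrite sum_chi_mul eq_sym (negPf ts) mul0r.
by [].
Qed.

Lemma walsh_eq0 z : (forall a, walsh z a = 0) -> forall s, z s = 0.
Proof.
move=> h s; have := parseval z; rewrite big1 => [|a _]; last by rewrite h.
move/esym/eqP; rewrite mulf_eq0 expf_eq0 andbF /=.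
rewrite psumr_eq0 => [/allP/(_ s)|t _]; last exact: sqr_ge0.
by rewrite mem_index_enum => /(_ isT) /=; rewrite sqrf_eq0 => /eqP.
Qed.

Lemma walsh_le z a : `|walsh z a| <= \sum_s `|z s|.
Proof.
apply: le_trans (ler_norm_sum _ _ _) _; apply: ler_sum => s _.
by rewrite normrM; case: (chi_pm1 a s) => ->; rewrite ?normrN1 ?normr1 mul1r.
Qed.

(** Poisson summation over the group of subsets of [I]; it is the source of all divisibility by
    powers of 2 below. *)
Lemma sum_walsh_sub z I :
  \sum_(J : P | J \subset I) walsh z J = 2 ^+ #|I| * \sum_(s : P | [disjoint s & I]) z s.
Proof.
rewrite exchange_big /= mulr_sumr [RHS]big_mkcond; apply: eq_bigr => s _ /=.
by rewrite -mulr_suml sum_chi_sub; case: ifP; rewrite ?mul0r.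
Qed.


(** * The rows of the sign matrix *)

(** The rows of small sets [i] are plain characters: the growth factor
2^(|i|-2) is only large enough to keep x_i dominant when |i| >= 5. *)
Definition high a := (5 <= #|a|)%N.

Definition lead (l : 'I_m) a b := [/\ l \in b, l \notin a &
  forall x : 'I_m, (l < x)%N -> (x \in a) = (x \in b)].

(** The last kind of row is chi_g (1 - 2 * 1_V) with V the annihilator of the
span W of g + i and of the singletons of i other than the leading bit [l] of
g + i; all elements of the coset g + W except i precede i in the binary order. *)
Variant row_spec i : (P -> int) -> Prop :=
| RowLow of ~~ high i : row_spec i (chi i)
| RowFirst of high i & (forall b, high b -> (num i <= num b)%N) :
    row_spec i (chi set0)
| RowNext g l of high i & high g & lead l g i &
    (forall b, high b -> (num b < num i)%N -> (num b <= num g)%N) :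
    row_spec i (fun s => if [disjoint s & i :\ l] then - chi i s else chi g s).

Lemma row_exists i : exists r, row_spec i r.
Proof.
case: (boolP (high i)) => [hi|]; last by exists (chi i); constructor.
case: (pickP (fun g => high g && (num g < num i)%N)) => [g0 hg0|none].
  have [g /andP[hg gi] gmax] :=
    @arg_maxnP _ g0 (fun g => high g && (num g < num i)%N) num hg0.
  have [l hl] := num_lead gi.
  exists (fun s => if [disjoint s & i :\ l] then - chi i s else chi g s).
  by constructor => // b hb bi; apply: gmax; rewrite hb.
exists (chi set0); constructor => // b hb; rewrite leqNgt.
by have := none b; rewrite /= hb /= => ->.
Qed.

Lemma row_pm1 i r : row_spec i r -> forall s, r s = 1 \/ r s = -1.
Proof.
case=> [_|_ _|g l _ _ _ _] s; try exact: chi_pm1.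
case: ifP => _; last exact: chi_pm1.
by case: (chi_pm1 i s) => ->; [right|left; rewrite opprK].
Qed.

(** The row is chi_g minus (chi_g + chi_i) times the indicator of the sets disjoint from [i :\ l],
    and that indicator is the average of chi_J over the subsets J of [i :\ l]. *)
Lemma row_next_expand g i (l : 'I_m) s :
  2 ^+ #|i :\ l| * (if [disjoint s & i :\ l] then - chi i s else chi g s) =
  2 ^+ #|i :\ l| * chi g s -
  \sum_(J : P | J \subset i :\ l) (chi (symd g J) s + chi (i :\: J) s).
Proof.
rewrite (eq_bigr (fun J => (chi g s + chi i s) * chi J s)) => [|J JI].
  by rewrite -mulr_sumr sum_chi_sub; case: ifP => _; ring.
rewrite -symd_sub ?chi_symd; last exact: subset_trans JI (subD1set _ _).
by ring.
Qed.

(** * Growth of the Walsh transform along the binary order *)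

Section Growth.
Variables (R : P -> P -> int) (z : P -> int).
Hypothesis rowR : forall i, row_spec i (R i).
Hypothesis Rz : forall i, `|\sum_s R i s * z s| <= 1.
Hypothesis z0 : \sum_s z s = 0.
Local Notation x := (walsh z).

Lemma walsh_dvd i : (forall J : P, J \proper i -> x J = 0) ->
  exists y, x i = 2 ^+ #|i| * y.
Proof.
move=> h; exists (\sum_(s : P | [disjoint s & i]) z s).
rewrite -sum_walsh_sub (bigD1 i) //= big1 ?addr0 // => J /andP[Ji nJ].
by apply: h; rewrite properEneq nJ.
Qed.

(** Induction on the size of [i]: the empty set gives the sum of [z]; otherwise x_i is a multiple of
    2^|i| >= 2, while the row chi_i forces |x_i| <= 1. *)
Lemma walsh_low i : ~~ high i -> x i = 0.
Proof.
have [k] := ubnP #|i|; elim: k i => // k IH i ik li.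
case: (eqVneq i set0) => [->|i0].
  by rewrite /walsh -[RHS]z0; apply: eq_bigr => s _; rewrite chi0 mul1r.
have [J /proper_card Ji|y xy] := @walsh_dvd i.
  apply: IH; first by apply: leq_trans Ji _; rewrite -ltnS.
  by apply: contra li; rewrite /high => /leq_trans; apply; exact: ltnW.
have : `|x i| <= 1.
  by have := Rz i; case: rowR li => [//|hi _|g l hi _ _ _]; rewrite hi.
rewrite xy -(prednK (n := #|i|)) ?card_gt0 // exprS.
by set q := 2 ^+ _; have : 1 <= q :> int by [rewrite exprn_ege1]; nia.
Qed.

(** The term J = [set0] is split off because it carries x_g and x_i themselves; every other term
    precedes [i] and differs from x_g. *)
Lemma walsh_next g i (l : 'I_m) :
  2 ^+ #|i :\ l| * (\sum_(s : P) (if [disjoint s & i :\ l] then - chi i s else chi g s) * z s) =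
  2 ^+ #|i :\ l| * x g - x g - x i -
  \sum_(J : P | (J \subset i :\ l) && (J != set0)) (x (symd g J) + x (i :\: J)).
Proof.
transitivity (2 ^+ #|i :\ l| * x g - \sum_(J : P | J \subset i :\ l) (x (symd g J) + x (i :\: J))).
  rewrite [X in _ = _ - X](eq_bigr (fun J => \sum_s (chi (symd g J) s + chi (i :\: J) s) * z s)).
    rewrite [X in _ = _ - X]exchange_big /= [walsh z g]/walsh !mulr_sumr -sumrB.
    apply: eq_bigr => s _.
    by rewrite mulrA row_next_expand -mulr_suml; ring.
  move=> J _; rewrite -big_split; apply: eq_bigr => s _ /=; ring.
rewrite (bigD1 set0) ?sub0set //= symd0 setD0; ring.
Qed.

(** log2 of the lower bound accumulated along the high sets up to [i]. *)
Definition weight i := (\sum_(j : P | high j && (num j <= num i)) (#|j| - 2))%N.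

(** Used with X = x_g, y = x_i, f the value of row i and S the remaining terms: |y| >= (3/4)(q -
    1)|X| - q, and the lower bounds on q and |X| absorb the loss. *)
Lemma dominated_growth q X S f y : 16 <= q -> 8 <= `|X| -> `|f| <= 1 ->
  4 * `|S| <= (q - 1) * `|X| -> q * f = q * X - X - y - S :> int ->
  q * `|X| <= 2 * `|y|.
Proof.
move=> hq hX hf hS e.
have -> : y = (q - 1) * X - q * f - S by lia.
have h1 : (q - 1) * `|X| - q - `|S| <= `|(q - 1) * X - q * f - S|.
  apply: le_trans (lerB_dist _ _); rewrite lerD2r.
  apply: le_trans (lerB_dist _ _); rewrite !normrM ger0_norm; last by lia.
  by rewrite lerD2l lerN2; nia.
nia.
Qed.

(** Strong induction in binary order. The factor 8 in the last clause keeps x_g dominant over all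
    earlier terms at the next step. *)
Lemma walsh_growth i : high i ->
  (forall b, high b -> (num b <= num i)%N -> x b = 0) \/
  [/\ 2 ^+ weight i <= `|x i|, 8 <= `|x i| &
      forall b, high b -> (num b < num i)%N -> 8 * `|x b| <= `|x i|].
Proof.
have [k] := ubnP (num i); elim: k i => // k IH i ik hi.
have sub0 g : high g -> (forall b, high b -> (num b <= num g)%N -> x b = 0) ->
  (forall b, high b -> (num b < num i)%N -> (num b <= num g)%N) ->
  forall J : P, J \proper i -> x J = 0.
  move=> hg g0 gi J Ji; case: (boolP (high J)) => [hJ|/walsh_low//].
  by apply: g0 => //; apply: gi => //; apply: num_proper.
have i5 : (1 < #|i|)%N by apply: leq_trans hi.
have := Rz i; case: rowR hi => [/negPf->//|_ imin hi _|g l _ hg hl gmax hi Rzi].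
  have first0 b : high b -> (num b < num i)%N -> False.
    by move=> hb; rewrite ltnNge imin.
  (* Proper subsets of the first high set are low, so x_i is a multiple of 2^|i| >= 32. *)
  have [J /num_proper Ji|y xy] := @walsh_dvd i.
    by apply: walsh_low; apply/negP => /first0; apply.
  case: (eqVneq y 0) => [y0|y0].
    left=> b hb; rewrite leq_eqVlt => /orP[/eqP/num_inj->|/first0 []//].
    by rewrite xy y0 mulr0.
  right; have h1 : 2 ^+ #|i| <= `|x i|.
    rewrite xy normrM ger0_norm ?exprn_ge0 // ler_peMr ?exprn_ge0 //.
    by move: y0; lia.
  have h2 : 2 ^+ 5 <= 2 ^+ #|i| :> int by rewrite ler_weXn2l.
  split=> [||b hb /(first0 _ hb)//]; last by move: h2 h1; lia.
  apply: le_trans h1; rewrite ler_weXn2l // /weight (bigD1 i) ?hi ?leqnn //=.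
  rewrite big1 ?addn0 ?leq_subr // => j /andP[/andP[hj ji] nji].
  case: (first0 j hj); rewrite ltn_neqAle ji andbT.
  by apply: contraNneq nji => /num_inj->.
have [li lg hlead] := hl.
have gi : (num g < num i)%N by apply: num_lead_lt hlead.
have card_I : #|i :\ l| = #|i|.-1 by rewrite (cardsD1 l i) li.
have := @walsh_next g i l; move: Rzi; set f := \sum_s _.
rewrite card_I; set q := 2 ^+ #|i|.-1; set S := \sum_(J | _) _ => hf e.
have q2 : 2 ^+ #|i| = 2 * q by rewrite -exprS prednK // ltnW.
have hq : 16 <= q.
  have : 2 ^+ 4 <= q by rewrite ler_weXn2l // -ltnS prednK // ltnW.
  by lia.
case: (IH g _ hg) => [|g0|[Fg g8 gdom]]; first exact: leq_trans gi _.
  left=> b hb; rewrite leq_eqVlt => /orP[/eqP/num_inj->|bi]; last first.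
    by apply: g0 => //; apply: gmax.
  have [//|y xy] := @walsh_dvd i; first exact: sub0 hg g0 gmax.
  have S0 : S = 0.
    apply: big1 => J /andP[JI J0].
    have z1 b' : (num b' < num i)%N -> x b' = 0.
      case: (boolP (high b')) => [hb' /(gmax _ hb')|/walsh_low//]; exact: g0.
    rewrite !z1 //; last exact: num_symd_lt JI.
    apply: num_proper; rewrite properEneq subsetDl andbT.
    have [w wJ] := set0Pn _ J0; have wi : w \in i.
      by have := subsetP JI w wJ; rewrite !inE => /andP[].
    by apply/eqP => /setP/(_ w); rewrite !inE wJ wi.
  (* All earlier terms vanish and x_i = 2 q y, so f = - 2 y; then |f| <= 1 forces y = 0. *)
  move: e; rewrite S0 xy q2 (g0 g) // => e.
  have /eqP : q * (f + 2 * y) = 0 by lia.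
  rewrite mulf_eq0 => /orP[/eqP|/eqP] h; first by lia.
  by have -> : y = 0 by [lia]; rewrite mulr0.
have dom b : (num b < num i)%N -> b != g -> 8 * `|x b| <= `|x g|.
  case: (boolP (high b)) => [hb /(gmax _ hb) bg nbg|/walsh_low-> _ _]; last first.
    by rewrite normr0 mulr0.
  apply: gdom => //; rewrite ltn_neqAle bg andbT.
  by apply: contraNneq nbg => /num_inj->.
(* There are q - 1 nonempty J, each contributing two terms of size at most |x_g| / 8. *)
have hS : 4 * `|S| <= (q - 1) * `|x g|.
  have hT J : (J \subset i :\ l) && (J != set0) ->
      4 * `|x (symd g J) + x (i :\: J)| <= `|x g|.
    move=> /andP[JI J0].
    have Ji : J \subset i by apply: subset_trans JI (subD1set _ _).
    have h1 : 8 * `|x (symd g J)| <= `|x g|.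
      apply: dom; first exact: num_symd_lt JI.
      apply: contraNneq J0 => h; rewrite -symd_eq0.
      apply/eqP/setP=> w; have /setP/(_ w) := h; rewrite !inE.
      by case: (w \in g); case: (w \in J).
    have h2 : 8 * `|x (i :\: J)| <= `|x g|.
      apply: dom.
        apply: num_proper; rewrite properEneq subsetDl andbT.
        have [w wJ] := set0Pn _ J0; have wi := subsetP Ji w wJ.
        by apply/eqP => /setP/(_ w); rewrite !inE wJ wi.
      (* The set [i :\: J] still contains [l], so it is not [g]. *)
      apply: contraNneq lg => <-; rewrite inE li andbT.
      by apply/negP => /(subsetP JI); rewrite !inE eqxx.
    have := ler_normD (x (symd g J)) (x (i :\: J)); lia.
  have hN : q - 1 = \sum_(J : P | (J \subset i :\ l) && (J != set0)) 1.
    have : q = \sum_(J : P | J \subset i :\ l) 1.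
      rewrite sumr_const /q -card_I -natrX -card_powerset.
      by congr (_%:R); apply: eq_card => J; rewrite inE.
    by rewrite (bigD1 set0) ?sub0set //= => ->; rewrite addrAC subrr add0r.
  rewrite hN mulr_suml; apply: le_trans (_ : 4 * \sum_(J : P | (J \subset i :\ l) && (J != set0))
     `|x (symd g J) + x (i :\: J)| <= _).
    by rewrite ler_pM2l // ler_norm_sum.
  by rewrite mulr_sumr; apply: ler_sum => J hJ; rewrite mul1r; apply: hT.
have main : q * `|x g| <= 2 * `|x i| by apply: dominated_growth e.
right; split.
- have -> : weight i = (weight g + (#|i| - 2))%N.
    rewrite /weight (bigD1 i) ?hi ?leqnn //= addnC; congr (_ + _)%N.
    apply: eq_bigl => j; case: (boolP (high j)) => //= hj.
    apply/andP/idP => [[ji nji]|jg].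
      apply: gmax => //; rewrite ltn_neqAle ji andbT.
      by apply: contraNneq nji => /num_inj->.
    split; first exact: leq_trans jg (ltnW gi).
    by apply: contraTneq gi => <-; rewrite -leqNgt.
  (* The growth factor from x_g to x_i is q / 2 = 2^(|i|-2), the increment of [weight]. *)
  have qE : q = 2 * 2 ^+ (#|i| - 2).
    by rewrite -exprS; congr (_ ^+ _); move: i5; lia.
  have : 0 <= 2 ^+ (#|i| - 2) :> int by rewrite exprn_ge0.
  by rewrite exprD; move: main Fg; rewrite qE; nia.
- by nia.
move=> b hb bi; case: (eqVneq b g) => [->|nbg]; first by nia.
by have := dom b bi nbg; nia.
Qed.

End Growth.

(** Pairing each set with its complement gives average size m/2; each set then loses at most 4,
    whether it is low or loses the 2 of [weight]. *)
Lemma weight_setT_ge : (m * 2 ^ m <= 2 * weight [set: 'I_m] + 8 * 2 ^ m)%N.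
Proof.
pose A := (\sum_(j : P) #|j|)%N.
pose B := (\sum_(j : P) (if high j then #|j| - 2 else 0))%N.
have cardP : #|P| = (2 ^ m)%N by rewrite -cardsT -powersetT card_powerset cardsT card_ord.
have A2 : (2 * A = m * 2 ^ m)%N.
  rewrite mul2n -addnn {2}/A (reindex_inj (@setC_inj _)) -big_split /=.
  rewrite (eq_bigr (fun=> m)) => [|j _]; last by rewrite cardsC card_ord.
  by rewrite sum_nat_const cardP mulnC.
have AB : (A <= B + 2 ^ m * 4)%N.
  rewrite -cardP -sum_nat_const -big_split /=.
  by apply: leq_sum => j _; rewrite /high; set k := #|j|; case: leqP; lia.
have -> : weight [set: 'I_m] = B.
  rewrite /B -big_mkcond; apply: eq_bigl => j.
  by rewrite num_sub ?subsetT ?andbT.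
by lia.
Qed.

(** * The gap in norm and the kernel of the sign matrix *)

Section Rows.
Variable R : P -> P -> int.
Hypothesis rowR : forall i, row_spec i (R i).
Hypothesis m5 : (5 <= m)%N.

Let high_setT : high [set: 'I_m].
Proof. by rewrite /high cardsT card_ord. Qed.

Lemma row_set0 s : R set0 s = 1.
Proof. by case: (rowR set0) => [_|_ _|g l]; rewrite ?chi0 // /high cards0. Qed.

Lemma rows_growth z : (forall i, `|\sum_s R i s * z s| <= 1) -> \sum_s z s = 0 ->
  (forall s, z s = 0) \/ 2 ^+ weight [set: 'I_m] <= \sum_s `|z s|.
Proof.
move=> Rz z0; have [x0|[h _ _]] := walsh_growth rowR Rz z0 high_setT; [left|right].
  apply: walsh_eq0 => a; case: (boolP (high a)) => [ha|]; last exact: walsh_low Rz z0 _.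
  by apply: x0; rewrite ?num_sub ?subsetT.
by apply: le_trans h _; apply: walsh_le.
Qed.

(** Both |R g| and |R w| are at most 1 in every row, hence so is |R z|. A large [z] gives [g] norm
    at least 2K - 1 >= K, where K is the claimed bound. *)
Lemma shifted_growth (g w z : P -> int) : (forall s, g s = w s + 2 * z s) ->
  (forall i, `|\sum_s R i s * g s| <= 1) -> \sum_s `|w s| <= 1 -> \sum_s z s = 0 ->
  \sum_s `|g s| <= 1 \/ 2 ^+ weight [set: 'I_m] <= \sum_s `|g s|.
Proof.
move=> gE Rg w1 z0; have Rz i : `|\sum_s R i s * z s| <= 1.
  have Rw : `|\sum_s R i s * w s| <= 1.
    apply: le_trans w1; apply: le_trans (ler_norm_sum _ _ _) _; apply: ler_sum => s _.
    by rewrite normrM; case: (row_pm1 (rowR i) s) => ->; rewrite ?normrN1 ?normr1 mul1r.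
  have : \sum_s R i s * g s = \sum_s R i s * w s + 2 * \sum_s R i s * z s.
    rewrite mulr_sumr -big_split; apply: eq_bigr => s _ /=; rewrite gE; ring.
  by have := Rg i; lia.
have [zE|zK] := rows_growth Rz z0; [left|right].
  by rewrite (eq_bigr (fun s => `|w s|)) // => s _; rewrite gE zE mulr0 addr0.
have zgw : 2 * \sum_s `|z s| <= \sum_s `|g s| + \sum_s `|w s|.
  rewrite mulr_sumr -big_split; apply: ler_sum => s _ /=; rewrite gE; lia.
have K1 : 1 <= 2 ^+ weight [set: 'I_m] :> int by rewrite exprn_ege1.
move: zK zgw w1 K1; set Z := \sum_s `|z s|; set W := \sum_s `|w s|.
by set G := \sum_s `|g s|; set K := 2 ^+ _; lia.
Qed.

(** Parseval bounds the sum of squares by 1, and |n| <= n^2 for integers. *)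
Lemma sum_norm_le1 (y : P -> int) : (forall a, `|walsh y a| <= 1) -> \sum_s `|y s| <= 1.
Proof.
move=> hy; have : 2 ^+ m * \sum_s y s ^+ 2 <= 2 ^+ m * 1.
  rewrite -parseval mulr1.
  have -> : 2 ^+ m = \sum_(a : P) 1 :> int.
    by rewrite sumr_const -cardsT -powersetT card_powerset cardsT card_ord natrX.
  by apply: ler_sum => a _; have := hy a; rewrite -[_ ^+ 2]real_normK ?num_real //; nia.
rewrite ler_pM2l ?exprn_gt0 //; apply: le_trans; apply: ler_sum => s _.
by rewrite -[_ ^+ 2]real_normK ?num_real //; nia.
Qed.

(** The empty set, whose row and character are both constantly 1, bounds the sum and the difference
    of the totals of [b] and [c] by 1, so one total is 0. Accordingly b + c is written as (b - c) +
    2c or (c - b) + 2b. *)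
Lemma cube_dichotomy (b c : P -> int) :
  (forall a, `|\sum_s chi a s * (b s - c s)| <= 1) ->
  (forall i, `|\sum_s R i s * (b s + c s)| <= 1) ->
  \sum_s `|b s + c s| <= 1 \/ 2 ^+ weight [set: 'I_m] <= \sum_s `|b s + c s|.
Proof.
move=> hb hR; have y1 : \sum_s `|b s - c s| <= 1 by exact: sum_norm_le1.
have s0 : `|\sum_s b s + \sum_s c s| <= 1.
  have := hR set0; rewrite (eq_bigr (fun s => b s + c s)) => [|s _].
    by rewrite big_split.
  by rewrite row_set0 mul1r.
have s1 : `|\sum_s b s - \sum_s c s| <= 1.
  have := hb set0; rewrite (eq_bigr (fun s => b s - c s)) => [|s _].
    by rewrite sumrB.
  by rewrite chi0 mul1r.
case: (eqVneq (\sum_s c s) 0) => [c0|c0].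
  by apply: (@shifted_growth _ (fun s => b s - c s) c) => // s; ring.
apply: (@shifted_growth _ (fun s => c s - b s) b) => // [s||].
- by ring.
- by rewrite (eq_bigr (fun s => `|b s - c s|)) // => s _; rewrite distrC.
by move: c0; lia.
Qed.

(** The rows of [set0] and of the first high set are both constantly 1, so the determinant
    vanishes. *)
Lemma rows_kernel : exists2 z : P -> int,
  (exists s, z s != 0) & forall i, \sum_s R i s * z s = 0.
Proof.
have [i0 hi0 imin] := @arg_minnP _ _ high num high_setT.
have Ri0 : R i0 =1 R set0.
  move=> s; rewrite row_set0; case: (rowR i0) => [||g l _ hg [li lg hl]].
  - by rewrite hi0.
  - by rewrite chi0.
  by have := num_lead_lt li lg hl; rewrite ltnNge imin.
pose A := \matrix_(i, j < #|P|) R (enum_val j) (enum_val i).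
have /eqP/det0P[v v0 vA] : \det A = 0.
  rewrite -det_tr; apply: (@determinant_alternate _ _ _ (enum_rank i0) (enum_rank set0)).
    rewrite (inj_eq enum_rank_inj); apply: contraTneq hi0 => ->.
    by rewrite /high cards0.
  by move=> j; rewrite !mxE !enum_rankK.
exists (fun s => v 0 (enum_rank s)).
  have /rV0Pn[j vj] := v0; exists (enum_val j); by rewrite enum_valK.
move=> i; have := congr1 (fun B : 'rV_ _ => B 0 (enum_rank i)) vA.
rewrite !mxE => h; rewrite -[RHS]h (reindex (@enum_val P predT)) /=.
  by apply: eq_bigr => j _; rewrite enum_valK !mxE enum_rankK mulrC.
by apply: onW_bij; exact: enum_val_bij.
Qed.

End Rows.
End Walsh.

(** * From combinations with multiplicities to minimal sequences *)

Lemma minimal_subseq (T : finType) d (V : T -> 'I_d -> int) (a : T -> nat) K :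
  (forall t, pm1_vec (V t)) -> (2 <= \sum_t a t)%N ->
  in_cube (fun j => \sum_t (a t)%:Z * V t j) ->
  (forall b : T -> nat, (2 <= \sum_t b t)%N ->
     in_cube (fun j => \sum_t (b t)%:Z * V t j) -> (K <= \sum_t b t)%N) ->
  exists t (v : 'I_t -> 'I_d -> int), pm1_minimal_seq v /\ (K <= t)%N.
Proof.
move=> Vpm a2 acube hK.
(* [W] lists [a t] separate copies of each [t], so subsequences are subsets of [W], and [mult]
   recovers their multiplicities. *)
pose W := {t : T & 'I_(a t)}.
pose mult (S : {set W}) t := #|[set w in S | tag w == t]|.
have sum_mult S : (\sum_t mult S t)%N = #|S|.
  rewrite -sum1_card (partition_big (fun w : W => tag w) predT) //=.
  by apply: eq_bigr => t _; rewrite sum1_card /mult; apply: eq_card => w; rewrite !inE.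
have sumV (S : {set W}) j : \sum_(w in S) V (tag w) j = \sum_t (mult S t)%:Z * V t j.
  rewrite (partition_big (fun w : W => tag w) predT) //=; apply: eq_bigr => t _.
  rewrite (eq_bigr (fun=> V t j)) => [|w /andP[_ /eqP->]//].
  rewrite sumr_const -mulr_natl natz; congr (Posz _ * _).
  by apply: eq_card => w; rewrite !inE.
pose good (S : {set W}) := (2 <= #|S|)%N && [forall j, `|\sum_(w in S) V (tag w) j| <= 1].
have multT t : mult setT t = a t.
  transitivity (\sum_(w : W | tag w == t) 1)%N.
    by rewrite sum1_card; apply: eq_card => w; rewrite !inE.
  rewrite (eq_bigl (fun w : W => (tag w == t) && true)) => [|w]; last by rewrite andbT.
  rewrite -(@sig_big_dep _ _ _ T (fun u => 'I_(a u)) (pred1 t)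
    (fun _ => predT) (fun _ _ => 1%N)) /=.
  by rewrite big_pred1_eq sum1_card card_ord.
have goodT : good setT.
  rewrite /good -sum_mult (eq_bigr _ (fun t _ => multT t)) a2.
  by apply/forallP => j; rewrite sumV (eq_bigr (fun t => (a t)%:Z * V t j)) // => t _;
    rewrite multT.
have [S /andP[S2 /forallP Scube] Smin] := @arg_minnP _ _ good (fun S => #|S|) goodT.
exists #|S|, (fun i => V (tag (enum_val i))); split; last first.
  by rewrite -sum_mult; apply: hK; [rewrite sum_mult | move=> j; rewrite -sumV].
split; first by move=> i; exact: Vpm.
split=> //; split.
  by move=> j; rewrite -(big_enum_val (fun w : W => V (tag w) j)).
move=> S' /andP[S'2 S't] S'cube.
pose U := [set enum_val i | i in S'].
have cardU : #|U| = #|S'| by rewrite card_imset //; exact: enum_val_inj.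
suff /Smin : good U by rewrite cardU leqNgt S't.
rewrite /good cardU S'2; apply/forallP => j.
by rewrite big_imset /=; [exact: S'cube | move=> u v _ _; exact: enum_val_inj].
Qed.

Lemma sum_bool_pair (T : finType) (V : nmodType) (F : bool * T -> V) :
  \sum_t F t = \sum_s (F (true, s) + F (false, s)).
Proof.
rewrite (eq_bigr (fun t => F (t.1, t.2))) => [|[]//].
by rewrite -(pair_big xpredT xpredT (fun e s => F (e, s))) /= big_bool -big_split.
Qed.

Lemma long_minimal_seq m : (5 <= m)%N ->
  exists t (v : 'I_t -> 'I_(2 * 2 ^ m) -> int),
    pm1_minimal_seq v /\ (2 ^ weight [set: 'I_m] <= t)%N.
Proof.
move=> m5; set d := (2 * 2 ^ m)%N; pose P : finType := {set 'I_m}.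
have [R rowR] : exists R : P -> P -> int, forall i, row_spec i (R i).
  exact: (fin_all_exists (@row_exists m)).
have [z [s0 z0] Rz] := rows_kernel rowR m5.
have cardC : d = #|{: bool * P}|.
  by rewrite card_prod card_bool /P -cardsT -powersetT card_powerset cardsT card_ord.
pose f (j : 'I_d) : bool * P := enum_val (cast_ord cardC j).
have fK c : {j | f j = c}.
  by exists (cast_ord (esym cardC) (enum_rank c)); rewrite /f cast_ordKV enum_rankK.
pose sg s : int := if z s < 0 then -1 else 1.
have sg_pm1 s : sg s = 1 \/ sg s = -1 by rewrite /sg; case: ifP; [right|left].
have sgz s : sg s * `|z s| = z s by rewrite /sg; case: ifP; lia.
(* In a coordinate [c] the boolean chooses between the R half and the Hadamard half; in a vector [t]
   it chooses the sign of the Hadamard half. *)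
pose entry (t c : bool * P) : int :=
  sg t.2 * (if c.1 then R c.2 t.2 else (if t.1 then chi c.2 t.2 else - chi c.2 t.2)).
have sum_row (b : bool * P -> nat) i :
    \sum_t (b t)%:Z * entry t (true, i) =
    \sum_s R i s * (sg s * (b (true, s))%:Z + sg s * (b (false, s))%:Z).
  by rewrite sum_bool_pair; apply: eq_bigr => s _; rewrite /entry /=; ring.
have sum_chi (b : bool * P -> nat) i :
    \sum_t (b t)%:Z * entry t (false, i) =
    \sum_s chi i s * (sg s * (b (true, s))%:Z - sg s * (b (false, s))%:Z).
  by rewrite sum_bool_pair; apply: eq_bigr => s _; rewrite /entry /=; ring.
(* Both vectors of each s occur |z_s| times: the Hadamard halves cancel and the R halves add up to 2
   R z = 0. *)
apply: (@minimal_subseq _ d (fun t j => entry t (f j)) (fun t => `|z t.2|%N)).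
- move=> t j; have := row_pm1 (rowR (f j).2) t.2; have := chi_pm1 (f j).2 t.2.
  rewrite /entry; set c := chi _ _; set r := R _ _.
  by case: (sg_pm1 t.2) => ->; case: (f j).1; case: t.1; lia.
- by rewrite (bigD1 (true, s0)) //= (bigD1 (false, s0)) //=; move: z0; lia.
- move=> j; case: (f j) => [[] i].
    rewrite sum_row (eq_bigr (fun s => 2 * (R i s * z s))) => [|s _].
      by rewrite -mulr_sumr Rz mulr0.
    by rewrite /= abszE sgz; ring.
  by rewrite sum_chi big1 // => s _; rewrite subrr mulr0.
move=> b b2 bcube.
(* Both multiplicities at s carry the same sign, so the l1-norm counts the terms exactly. *)
have norm_sum : \sum_s `|sg s * (b (true, s))%:Z + sg s * (b (false, s))%:Z| =
    (\sum_t b t)%N%:Z.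
  rewrite -natz natr_sum sum_bool_pair; apply: eq_bigr => s _.
  rewrite !natz -mulrDr normrM -PoszD.
  by case: (sg_pm1 s) => ->; rewrite ?normrN1 ?normr1 mul1r.
have := @cube_dichotomy _ R rowR m5 (fun s => sg s * (b (true, s))%:Z)
  (fun s => sg s * (b (false, s))%:Z).
rewrite norm_sum => /(_ _ _) [i|i||].
- by have [j fj] := fK (false, i); have := bcube j; rewrite /= fj sum_chi.
- by have [j fj] := fK (true, i); have := bcube j; rewrite /= fj sum_row.
- by move=> h; move: b2; rewrite ltnNge -lez_nat h.
by rewrite -natrX natz lez_nat.
Qed.

Lemma two_term_seq d : exists v : 'I_2 -> 'I_d -> int, pm1_minimal_seq v.
Proof.
exists (fun i _ => if i == ord0 then 1 else -1); split.
  by move=> i j; case: ifP; [left|right].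
split=> //; split; first by move=> j; rewrite big_ord_recr big_ord1.
by move=> S /andP[h1 h2]; rewrite leqNgt h2 in h1.
Qed.

Lemma expn_pow a n : Nat.pow a n = (a ^ n)%N.
Proof. by elim: n => //= n ->; rewrite expnS. Qed.

(** With m = k - 1, the weight is at least (m - 8) 2^(m-1) = (k - 9) 2^(k-2). *)
Lemma long_minimal_seq_pow k : (9 < k)%N ->
  exists t (v : 'I_t -> 'I_(Nat.pow 2 k) -> int),
    pm1_minimal_seq v /\ (Nat.pow 2 ((k - 9) * Nat.pow 2 (k - 2)) <= t)%N.
Proof.
case: k => [|m] // m9; rewrite !expn_pow expnS.
have [|t [v [hv ht]]] := @long_minimal_seq m; first by lia.
exists t, v; split=> //; apply: leq_trans ht; rewrite leq_pexp2l //.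
have := weight_setT_ge m.
have -> : (2 ^ m = 2 * 2 ^ (m.+1 - 2))%N by rewrite -expnS; congr (_ ^ _)%N; lia.
by set N := (2 ^ _)%N; nia.
Qed.
End Construction.

(* The bound over the reals *)
From Stdlib Require Import Reals.
From Stdlib Require Lra.

Lemma Rpower_le_one (x y : R) : (0 < x <= 1 -> 0 <= y -> Rpower x y <= 1)%R.
Proof.
move=> [x0 x1] y0; rewrite -exp_0 /Rpower.
have lnx : (ln x <= 0)%R.
  by rewrite -ln_1; case: x1 => [h|->]; [left; apply: ln_increasing | right].
have : (y * ln x <= 0)%R by Lra.nra.
by case=> [h|->]; [left; apply: exp_increasing | right].
Qed.

Theorem theorem3 :
  exists c : R, (0 < c)%R /\
    forall k : nat,
      exists (t : nat) (v : 'I_t -> 'I_(2 ^ k) -> int),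
        pm1_minimal_seq v /\
        (Rpower (c * INR (2 ^ k)) (INR (2 ^ k) / 4) <= INR t)%R.
Proof.
(* Since 512 = 2^9, c d is 2^(k-9), and its power d/4 = 2^(k-2) is exactly the integer bound. *)
exists (/ 512)%R; split=> [|k]; first by Lra.lra.
have pow2 n : (INR (Nat.pow 2 n) = 2 ^ n)%R by rewrite pow_INR.
have pow2_gt0 n : (0 < 2 ^ n)%R by apply: pow_lt; Lra.lra.
(* For k <= 9 the base c d is at most 1, so two opposite vectors suffice. *)
case: (leqP k 9) => [k9|k10].
  have [v hv] := Construction.two_term_seq (Nat.pow 2 k); exists 2, v; split=> //.
  have le512 : (2 ^ k <= 512)%R.
    have -> : (512 = 2 ^ 9)%R by simpl; Lra.lra.
    by apply: Rle_pow; [Lra.lra | apply/leP].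
  have ge0 := pow2_gt0 k; rewrite pow2.
  apply: (Rle_trans _ 1); last by simpl; Lra.lra.
  by apply: Rpower_le_one; Lra.lra.
have [t [v [hv ht]]] := Construction.long_minimal_seq_pow k10.
exists t, v; split=> //.
have baseE : (/ 512 * INR (Nat.pow 2 k) = 2 ^ (k - 9))%R.
  have kE : (k = 9 + (k - 9))%coq_nat by rewrite -[RHS]/(addn _ _) subnKC // ltnW.
  by rewrite pow2 {1}kE pow_add; simpl; Lra.lra.
have expE : (INR (Nat.pow 2 k) / 4 = INR (Nat.pow 2 (k - 2)))%R.
  have kE : (k = 2 + (k - 2))%coq_nat.
    by rewrite -[RHS]/(addn _ _) subnKC //; apply: leq_trans k10.
  by rewrite !pow2 {1}kE pow_add; simpl; Lra.lra.
rewrite baseE expE Rpower_pow // -pow_mult -pow2.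
by apply: le_INR; apply/leP.
Qed.
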